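(* There exists an absolute constant $\epsilon_0>0$ such that for any $\epsilon\in(0,\epsilon_0)$, any algorithm that, given sample access to an unknown product distribution $P$ over $\{0,1\}^n$, distinguishes with probability at least $2/3$ between $P=P^\ast$ and $\|P-P^\ast\|_1>\epsilon$ requires $\Omega(\sqrt n/\epsilon^2)$ samples, where $P^\ast=\mathrm{Bern}(1/n)^{\otimes n}$ is the product distribution on $\{0,1\}^n$ with all coordinate means equal to $1/n$.
   Context: A product distribution over $\{0,1\}^n$ is one with independent coordinates. $\|P-Q\|_1=\sum_x|P(x)-Q(x)|$. *)

(* Defs.v *)
From HB Require Import structures.
From mathcomp Require Import all_boot all_order all_algebra.
From mathcomp Require Import reals bernoulli_distribution.

Set Implicit Arguments.
Unset Strict Implicit.
Unset Printing Implicit Defensive.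

Import Order.TTheory GRing.Theory Num.Theory.

Local Open Scope ring_scope.

Definition is_dist (R : realType) (T : finType) (P : {ffun T -> R}) : Prop :=
  (forall x, 0 <= P x) /\ \sum_x P x = 1.

Definition cube (n : nat) : finType := {ffun 'I_n -> bool}.

Definition marginal (R : realType) (n : nat) (P : {ffun cube n -> R})
    (i : 'I_n) (b : bool) : R :=
  \sum_(x : cube n | x i == b) P x.

(* Independence of the coordinates: the joint mass function is the product of
   the marginal ones. *)
Definition is_product_dist (R : realType) (n : nat)
    (P : {ffun cube n -> R}) : Prop :=
  is_dist P /\ forall x : cube n, P x = \prod_(i < n) marginal P i (x i).

Definition bern_prod (R : realType) (n : nat) (p : R) : {ffun cube n -> R} :=
  [ffun x : cube n => \prod_(i < n) bernoulli_pmf p (x i)].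

Definition l1_dist (R : realType) (T : finType) (P Q : {ffun T -> R}) : R :=
  \sum_x `|P x - Q x|.

Definition samples (T : finType) (m : nat) : finType := {ffun 'I_m -> T}.

(* The possibly randomized algorithm is given by the law [A s] of its answer
   on the sample sequence [s]. *)
Definition is_algorithm (R : realType) (T : finType) (m : nat)
    (A : samples T m -> {ffun bool -> R}) : Prop :=
  forall s, is_dist (A s).

(* The probability is over both the m i.i.d. samples from P and the internal
   randomness of the algorithm. *)
Definition pr_answer (R : realType) (T : finType) (m : nat)
    (A : samples T m -> {ffun bool -> R}) (P : {ffun T -> R}) (b : bool) : R :=
  \sum_(s : samples T m) (\prod_(j < m) P (s j)) * A s b.

(* The answer [true] stands for "P = Pstar". *)
Definition distinguishes (R : realType) (n m : nat)
    (Pstar : {ffun cube n -> R}) (eps : R)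
    (A : samples (cube n) m -> {ffun bool -> R}) : Prop :=
  forall P : {ffun cube n -> R}, is_product_dist P ->
    (P = Pstar -> 2 / 3 <= pr_answer A P true) /\
    (eps < l1_dist P Pstar -> 2 / 3 <= pr_answer A P false).

Lemma sum_bernoulli_pmf (R : realType) (p : R) :
  \sum_(b : bool) bernoulli_pmf p b = 1.
Proof. by rewrite big_bool /= addrC subrK. Qed.

Lemma marginal_bern_prod (R : realType) (n : nat) (p : R) (i : 'I_n) (b : bool) :
  marginal (bern_prod n p) i b = bernoulli_pmf p b.
Proof.
rewrite /marginal.
pose F (j : 'I_n) (c : bool) : R :=
  if (j == i) && (c != b) then 0 else bernoulli_pmf p c.
transitivity (\sum_(x : cube n) \prod_(j < n) F j (x j)).
  rewrite big_mkcond; apply: eq_bigr => x _; rewrite ffunE.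
  case: eqP => [xib|/eqP xib].
    by apply: eq_bigr => j _; rewrite /F; case: eqP => [->|] //=; rewrite xib eqxx.
  by rewrite (bigD1 i) //= /F eqxx xib mul0r.
rewrite -(bigA_distr_bigA F) (bigD1 i) //=.
have -> : \prod_(j < n | j != i) \sum_c F j c = 1.
  apply: big1 => j /negPf ji; rewrite -(sum_bernoulli_pmf p).
  by apply: eq_bigr => c _; rewrite /F ji.
rewrite mulr1 (bigD1 b) //= /F !eqxx /= big1 ?addr0 // => c cb.
by rewrite cb.
Qed.

Lemma is_product_dist_bern_prod (R : realType) (n : nat) (p : R) :
  0 <= p <= 1 -> is_product_dist (bern_prod n p).
Proof.
move=> p01; split; first split.
- by move=> x; rewrite ffunE; apply: prodr_ge0 => i _; exact: bernoulli_pmf_ge0.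
- under eq_bigr do rewrite ffunE.
  rewrite -(bigA_distr_bigA (fun (i : 'I_n) b => bernoulli_pmf p b)) /=.
  by apply: big1 => i _; exact: sum_bernoulli_pmf.
- move=> x; rewrite ffunE; apply: eq_bigr => i _.
  by rewrite marginal_bern_prod.
Qed.

(* Main.v *)
(** Paninski-type argument. Perturb every mean to [(1 ± d) / n] with
    independent uniform signs and [d = 16 eps]. Whatever the signs are, at
    least half of the coordinates move in the same direction, and the event
    that about [n / 2] of these all vanish has its probability changed by at
    least [d / 8]; so every perturbation is [eps]-far from the reference.
    On the other hand, the likelihood ratio of the uniform mixture of the
    perturbed [m]-sample laws has second moment
    [(((1 + t) ^ m + (1 - t) ^ m) / 2) ^ n] with [t = d ^ 2 / (n - 1)], which
    is close to [1] unless [n m ^ 2 t ^ 2], of order [m ^ 2 eps ^ 4 / n], is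
    bounded below. A second moment close to [1] prevents any test from
    succeeding. *)

Require Import Defs.
From HB Require Import structures.
From mathcomp Require Import all_boot all_order all_algebra.
From mathcomp Require Import reals bernoulli_distribution ring lra zify.

Import Order.TTheory GRing.Theory Num.Theory.

Local Open Scope ring_scope.

(** * Elementary inequalities on powers *)

Lemma exprB1_ge (R : realFieldType) (x : R) (n : nat) :
  0 <= x <= 1 -> 1 - n%:R * x <= (1 - x) ^+ n.
Proof.
move=> /andP[x0 x1]; elim: n => [|n IHn]; first by rewrite expr0 mul0r subr0.
have n0 : 0 <= n%:R :> R by exact: ler0n.
rewrite exprS -natr1; have : (1 - x) * (1 - n%:R * x) <= (1 - x) * (1 - x) ^+ n.
  by rewrite ler_wpM2l // subr_ge0.
have : 0 <= n%:R * (x * x) by rewrite !mulr_ge0.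
nra.
Qed.

(** Since [(1 + x) ^+ n * (1 - x) ^+ n <= 1], the lower bound on [(1 - x) ^+ n] turns into an upper
    bound on [(1 + x) ^+ n]. *)
Lemma exprD1_le (R : realFieldType) (x : R) (n : nat) :
  0 <= x -> n%:R * x < 1 -> (1 + x) ^+ n <= (1 - n%:R * x)^-1.
Proof.
move=> x0 nx1; have pos : 0 < 1 - n%:R * x by rewrite subr_gt0.
rewrite -[leRHS]mul1r ler_pdivlMr //.
have [->|n0] := posnP n; first by rewrite expr0 mul0r subr0 mulr1.
have x1 : x <= 1.
  by apply: le_trans (ltW nx1); rewrite ler_peMl // ler1n.
have xD0 : 0 <= 1 + x by rewrite addr_ge0.
apply: (@le_trans _ _ ((1 + x) ^+ n * (1 - x) ^+ n)).
  by rewrite ler_wpM2l ?exprn_ge0 // exprB1_ge // x0.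
rewrite -exprMn exprn_ile1 //; last by nra.
by rewrite mulr_ge0 // subr_ge0.
Qed.

Lemma exprB_ge (R : realFieldType) (a b : R) (k : nat) :
  0 <= a <= b -> k.+1%:R * (b - a) * a ^+ k <= b ^+ k.+1 - a ^+ k.+1.
Proof.
move=> /andP[a0 ab]; elim: k => [|k IHk]; first by rewrite expr0 !expr1 mul1r mulr1.
have b0 : 0 <= b by exact: le_trans a0 ab.
have -> : b ^+ k.+2 - a ^+ k.+2 = b * (b ^+ k.+1 - a ^+ k.+1) + (b - a) * a ^+ k.+1.
  by rewrite !exprS; ring.
have -> : k.+2%:R * (b - a) * a ^+ k.+1 =
    a * (k.+1%:R * (b - a) * a ^+ k) + (b - a) * a ^+ k.+1.
  by rewrite -[k.+2%:R]natr1 exprS; ring.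
by rewrite lerD2r; apply: ler_pM; rewrite ?mulr_ge0 ?exprn_ge0 ?subr_ge0.
Qed.

(** Averaging over the sign of [t] cancels the linear term. This quadratic gain yields the factor
    [sqrt n]: a bound linear in [m t] would only give order [1 / eps ^ 2] samples. *)
Lemma even_part_le (R : realFieldType) (t : R) (m : nat) : 0 <= t -> m%:R * t <= 1 ->
  ((1 + t) ^+ m + (1 - t) ^+ m) / 2 <= 1 + (m%:R * t) ^+ 2.
Proof.
move=> t0 mt.
(* The odd part of [(1 + t) ^ m] has to be bounded in the same induction. *)
suff [] : ((1 + t) ^+ m + (1 - t) ^+ m) / 2 <= 1 + (m%:R * t) ^+ 2 /\
          ((1 + t) ^+ m - (1 - t) ^+ m) / 2 <= 2 * (m%:R * t) by [].
elim: m mt => [|m IHm]; first by rewrite !expr0 mul0r; split; lra.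
rewrite -natr1 mulrDl mul1r => mt.
have m0 : 0 <= m%:R * t by rewrite mulr_ge0.
have [] := IHm ltac:(lra).
rewrite !exprS; set u := (1 + t) ^+ m; set v := (1 - t) ^+ m.
rewrite expr0; move: (m%:R * t) m0 mt => y y0 yt hu hv.
have h1 : t * ((u - v) / 2) <= t * (2 * y) by rewrite ler_wpM2l.
have h2 : t * ((u + v) / 2) <= t * (1 + y * (y * 1)) by rewrite ler_wpM2l.
have h3 : y * y <= 1 by nra.
split; nra.
Qed.

(** Here [W] is the reference law, [L] a likelihood ratio and [a] the probability of rejection. The
    constant [32 / 27] is the solution [X] of [2 / 3 = 3 / 2 * X - 3 / 2 + 7 / 18]. *)
Lemma second_moment_ge (R : realFieldType) (T : finType) (W L a : T -> R) :
  (forall s, 0 <= W s) -> (forall s, 0 <= a s <= 1) ->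
  \sum_s W s = 1 -> \sum_s W s * L s = 1 ->
  \sum_s W s * a s <= 1 / 3 -> 2 / 3 <= \sum_s W s * L s * a s ->
  32 / 27 <= \sum_s W s * L s ^+ 2.
Proof.
move=> W0 a01 W1 WL1 Wa WLa.
(* AM-GM: [(L - 1) a <= 3 (L - 1)^2 / 2 + a^2 / 6], and [a^2 <= a]. *)
have pt s : W s * L s * a s <=
    3 / 2 * (W s * L s ^+ 2) + (- 3) * (W s * L s) + 3 / 2 * W s + 7 / 6 * (W s * a s).
  have /andP[a0 a1] := a01 s.
  have -> : 3 / 2 * (W s * L s ^+ 2) + (- 3) * (W s * L s) + 3 / 2 * W s
      + 7 / 6 * (W s * a s) =
    W s * (3 / 2 * L s ^+ 2 + (- 3) * L s + 3 / 2 + 7 / 6 * a s) by ring.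
  rewrite -mulrA ler_wpM2l // -subr_ge0.
  have -> : 3 / 2 * L s ^+ 2 + (- 3) * L s + 3 / 2 + 7 / 6 * a s - L s * a s =
     (3 * (L s - 1) - a s) ^+ 2 / 6 + a s * (1 - a s) / 6 by field.
  by rewrite addr_ge0 ?divr_ge0 ?sqr_ge0 ?mulr_ge0 ?subr_ge0.
have := ler_sum (index_enum T) (fun s (_ : true) => pt s).
rewrite !big_split /= -!mulr_sumr W1 WL1; lra.
Qed.

(** * Product Bernoulli laws, events and samples *)

Definition prod_bernoulli {R : realType} {n : nat} (p : 'I_n -> R) :
    {ffun cube n -> R} :=
  [ffun x : cube n => \prod_(i < n) bernoulli_pmf (p i) (x i)].

Lemma sum_prod_bernoulli_cylinder (R : realType) (n : nat) (p : 'I_n -> R)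
    (S : {set 'I_n}) (c : 'I_n -> bool) :
  \sum_(x : cube n | [forall i in S, x i == c i]) prod_bernoulli p x =
  \prod_(i in S) bernoulli_pmf (p i) (c i).
Proof.
(* Zeroing the forbidden factors turns the sum over the cylinder into one over the whole cube, which
   factorises. *)
pose F (j : 'I_n) (b : bool) : R :=
  if (j \in S) && (b != c j) then 0 else bernoulli_pmf (p j) b.
transitivity (\sum_(x : cube n) \prod_(j < n) F j (x j)).
  rewrite big_mkcond; apply: eq_bigr => x _; rewrite ffunE.
  case: ifPn => [/forall_inP xS|].
    by apply: eq_bigr => j _; rewrite /F; case: ifPn => // /andP[/xS ->].
  rewrite negb_forall_in => /exists_inP[j jS xj].
  by rewrite (bigD1 j) //= /F jS xj mul0r.
rewrite -(bigA_distr_bigA F) [RHS]big_mkcond; apply: eq_bigr => j _.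
rewrite big_bool /F; case: (j \in S) => /=; last by rewrite addrC subrK.
by case: (c j); rewrite /= ?addr0 ?add0r.
Qed.

Lemma is_product_dist_prod_bernoulli (R : realType) (n : nat) (p : 'I_n -> R) :
  (forall i, 0 <= p i <= 1) -> is_product_dist (prod_bernoulli p).
Proof.
move=> p01; split; first split.
- by move=> x; rewrite ffunE; apply: prodr_ge0 => i _; exact: bernoulli_pmf_ge0.
- have := sum_prod_bernoulli_cylinder R n p set0 (fun=> true).
  rewrite big_set0 => <-; apply: eq_bigl => x.
  by symmetry; apply/forall_inP => i; rewrite inE.
- move=> x; rewrite {1}ffunE; apply: eq_bigr => i _.
  have := sum_prod_bernoulli_cylinder R n p [set i] (fun=> x i).
  rewrite big_set1 => <-; apply: eq_bigl => y.
  apply/forall_inP/idP => [|yi j /set1P -> //].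
  by apply; rewrite inE.
Qed.

Lemma l1_dist_ge_event (R : realType) (T : finType) (P Q : {ffun T -> R})
    (E : pred T) :
  `|\sum_(x | E x) P x - \sum_(x | E x) Q x| <= l1_dist P Q.
Proof.
rewrite -sumrB; apply: le_trans (ler_norm_sum _ _ _) _.
by rewrite /l1_dist [leRHS](bigID E) /= lerDl sumr_ge0.
Qed.

Lemma sum_samples (R : realType) (T : finType) (m : nat) (f : T -> R) :
  \sum_(s : samples T m) \prod_(j < m) f (s j) = (\sum_t f t) ^+ m.
Proof.
by rewrite -(bigA_distr_bigA (fun (_ : 'I_m) => f)) prodr_const card_ord.
Qed.

(** * Perturbed laws and their likelihood ratios *)

Definition rsign (R : realType) (b : bool) : R := if b then 1 else -1.

Definition perturb {R : realType} {n : nat} (p d : R) (z : cube n) : 'I_n -> R :=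
  fun i => p * (1 + rsign R (z i) * d).

(** Relative change of the mass of [b] when the mean moves from [p] to [p * (1 + d)]. *)
Definition tilt {R : realType} (p d : R) (b : bool) : R :=
  if b then d else - (d * p / (1 - p)).

Definition lratio {R : realType} {n : nat} (p d : R) (z x : cube n) : R :=
  \prod_(i < n) (1 + rsign R (z i) * tilt p d (x i)).

Lemma prod_bernoulli_perturb (R : realType) (n : nat) (p d : R) (z x : cube n) :
  p < 1 ->
  prod_bernoulli (perturb p d z) x = bern_prod n p x * lratio p d z x.
Proof.
move=> p1; rewrite !ffunE -big_split; apply: eq_bigr => i _ /=.
by rewrite /perturb /tilt; case: (x i) => //=; field; lra.
Qed.

(** Under the Bernoulli law of mean [p], [tilt] has mean 0 and second moment [d ^+ 2 * p / (1 - p)],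
    so in each coordinate only the product of the two tilts survives. *)
Lemma lratio_correlation (R : realType) (n : nat) (p d : R) (z w : cube n) :
  p < 1 ->
  \sum_(x : cube n) bern_prod n p x * (lratio p d z x * lratio p d w x) =
  \prod_(i < n) (1 + rsign R (z i) * rsign R (w i) * (d ^+ 2 * p / (1 - p))).
Proof.
move=> p1.
pose F (i : 'I_n) (b : bool) := bernoulli_pmf p b *
  ((1 + rsign R (z i) * tilt p d b) * (1 + rsign R (w i) * tilt p d b)).
transitivity (\sum_(x : cube n) \prod_(i < n) F i (x i)).
  by apply: eq_bigr => x _; rewrite ffunE -!big_split.
rewrite -(bigA_distr_bigA F); apply: eq_bigr => i _.
by rewrite big_bool /F /tilt /=; field; lra.
Qed.

(** For fixed [z], the product of the two signs at [i] takes each value once as [w i] varies, so the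
    sum does not depend on [z]. *)
Lemma sum_rsign_prod (R : realType) (n m : nat) (t : R) (z : cube n) :
  \sum_(w : cube n) (\prod_(i < n) (1 + rsign R (z i) * rsign R (w i) * t)) ^+ m =
  ((1 + t) ^+ m + (1 - t) ^+ m) ^+ n.
Proof.
pose F (i : 'I_n) (b : bool) := (1 + rsign R (z i) * rsign R b * t) ^+ m.
transitivity (\sum_(w : cube n) \prod_(i < n) F i (w i)).
  by apply: eq_bigr => w _; rewrite -prodrXl.
rewrite -(bigA_distr_bigA F) -[in RHS](card_ord n) -prodr_const.
apply: eq_bigr => i _; rewrite big_bool /F /rsign.
by case: (z i); rewrite !(mul1r, mulN1r, opprK) //= addrC.
Qed.

(** * Distance of the perturbations from the reference law *)

Lemma perturb_l1_dist (R : realType) (n : nat) (d : R) (z : cube n) :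
  (2 <= n)%N -> 0 <= d <= 1 / 2 ->
  d / 8 <= l1_dist (prod_bernoulli (perturb (1 / n%:R) d z))
                   (bern_prod n (1 / n%:R)).
Proof.
move=> n2 /andP[d0 d2]; set p := 1 / n%:R.
(* [k.+1] is [n / 2] rounded up: large enough for [k.+1 * p >= 1 / 2], while [k * p <= 1 / 2]. *)
have [k kn kn'] : exists2 k, (n <= k.+1.*2)%N & (k.*2 < n)%N.
  by exists (uphalf n).-1; lia.
have [b [S [Sk Sz]]] : exists b, exists S : {set 'I_n},
    #|S| = k.+1 /\ {in S, forall i, z i = b}.
  have [b hb] : exists b, (k < #|[set i | z i == b]|)%N.
    have := cardsC [set i | z i]; rewrite card_ord => cz.
    have [h|h] := ltnP k #|[set i | z i]|.
      exists true; apply: leq_trans h _; apply: subset_leq_card.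
      by apply/subsetP => i; rewrite !inE => ->.
    exists false; apply: (@leq_trans #|~: [set i | z i]|); first by lia.
    by apply: subset_leq_card; apply/subsetP => i; rewrite !inE; case: (z i).
  have /card_geqP[s [us ss sA]] := hb.
  exists b, [set i in s]; split.
    by rewrite cardsE -ss; apply/card_uniqP.
  by move=> i; rewrite inE => /sA; rewrite inE => /eqP.
have nR : 2 <= n%:R :> R by rewrite ler_nat.
have np : n%:R * p = 1 by rewrite /p; field; lra.
have p0 : 0 < p by rewrite /p divr_gt0 //; lra.
have p2 : p <= 1 / 2 by nra.
have kp : 1 / 2 <= k.+1%:R * p.
  have : n%:R <= 2 * k.+1%:R :> R by rewrite -natrM ler_nat; lia.
  nra.
have kp' : k%:R * p <= 1 / 2.
  have : 2 * k%:R <= n%:R :> R by rewrite -natrM ler_nat; lia.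
  nra.
pose E (x : cube n) := [forall i in S, x i == false].
apply: le_trans (l1_dist_ge_event R _ _ _ E).
have mass (q : 'I_n -> R) (r : R) : {in S, forall i, q i = r} ->
    \sum_(x | E x) prod_bernoulli q x = (1 - r) ^+ k.+1.
  move=> qr; rewrite /E (sum_prod_bernoulli_cylinder R n q S (fun=> false)) /=.
  rewrite -Sk -prodr_const; apply: eq_bigr => i iS.
  by rewrite /bernoulli_pmf qr.
rewrite (mass _ (p * (1 + rsign R b * d))); last by move=> i iS; rewrite /perturb Sz.
rewrite (mass (fun=> p) p) //.
(* [a] and [c] are the two probabilities that one coordinate vanishes. As [d <= 1 / 2], no mean
   exceeds [3 / 2 * p], so [a ^+ k >= 1 - 3 / 4]; the [1 / 8] is [1 / 2] from [k.+1 * p] times this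
   [1 / 4]. *)
have gap (a c : R) : 1 - 3 / 2 * p <= a <= c -> c - a = p * d ->
    d / 8 <= c ^+ k.+1 - a ^+ k.+1.
  move=> /andP[ha ac] cad.
  have a0 : 0 <= a by nra.
  apply: le_trans (exprB_ge R a c k _); last by rewrite a0.
  rewrite cad mulrA -mulrA [leRHS]mulrA.
  have hak : 1 / 4 <= a ^+ k.
    apply: (@le_trans _ _ ((1 - 3 / 2 * p) ^+ k)); last first.
      by apply: lerXn2r => //; rewrite nnegrE //; nra.
    apply: le_trans (exprB1_ge R (3 / 2 * p) k _); last by apply/andP; split; nra.
    by rewrite mulrCA; nra.
  have h1 : 1 / 2 * d <= k.+1%:R * p * d by rewrite ler_wpM2r.
  have h2 : 1 / 2 * d * (1 / 4) <= k.+1%:R * p * d * a ^+ k.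
    by apply: ler_pM => //; lra.
  lra.
case: b {Sz} => /=.
- rewrite distrC; apply: le_trans (ler_norm _); apply: gap; last by lra.
  by apply/andP; split; nra.
- apply: le_trans (ler_norm _); apply: gap; last by lra.
  by apply/andP; split; nra.
Qed.

(** * Second moment of the uniform mixture *)

Lemma mixture_second_moment_ge (R : realType) (n m : nat) (p d : R)
    (A : samples (cube n) m -> {ffun bool -> R}) :
  0 <= p < 1 -> 0 <= d <= 1 -> p * (1 + d) <= 1 -> is_algorithm A ->
  2 / 3 <= pr_answer A (bern_prod n p) true ->
  (forall z, 2 / 3 <= pr_answer A (prod_bernoulli (perturb p d z)) false) ->
  32 / 27 <= (((1 + d ^+ 2 * p / (1 - p)) ^+ m
               + (1 - d ^+ 2 * p / (1 - p)) ^+ m) / 2) ^+ n.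
Proof.
move=> /andP[p0 p1] /andP[d0 d1] pd algA hnull halt.
pose W (s : samples (cube n) m) := \prod_(j < m) bern_prod n p (s j).
pose Lz (z : cube n) (s : samples (cube n) m) := \prod_(j < m) lratio p d z (s j).
pose N : R := 2 ^+ n.
have N0 : N != 0 by rewrite expf_neq0 // pnatr_eq0.
have cardN : #|cube n|%:R = N.
  by rewrite /N card_ffun card_bool card_ord natrX.
pose L s := N^-1 * \sum_z Lz z s.
have [[P0 P1] _] : is_product_dist (bern_prod n p).
  by apply: is_product_dist_bern_prod; rewrite p0 ltW.
have W0 s : 0 <= W s by exact: prodr_ge0.
have W1 : \sum_s W s = 1 by rewrite sum_samples P1 expr1n.
have WLz z s : W s * Lz z s = \prod_(j < m) prod_bernoulli (perturb p d z) (s j).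
  rewrite -big_split; apply: eq_bigr => j _.
  by rewrite prod_bernoulli_perturb.
have A01 s : 0 <= A s false <= 1.
  have [A0 A1] := algA s; rewrite A0 -A1 big_bool /= lerDr; exact: A0.
(* Used with [f] equal to 1, to the rejection probability, and to [L] itself. *)
have mix (f : samples (cube n) m -> R) :
    \sum_s W s * L s * f s = N^-1 * \sum_z \sum_s W s * Lz z s * f s.
  rewrite exchange_big /= mulr_sumr; apply: eq_bigr => s _.
  by rewrite -mulr_suml -mulr_sumr /L; ring.
have avg (c : R) : N^-1 * \sum_(z : cube n) c = c.
  by rewrite sumr_const -[c *+ _]mulr_natl cardN mulKf.
have WL1 : \sum_s W s * L s = 1.
  under eq_bigr do rewrite -[_ * L _]mulr1.
  rewrite mix -[RHS]avg; congr (_ * _); apply: eq_bigr => z _.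
  under eq_bigr do rewrite mulr1 WLz.
  have [[_ Pz1] _] : is_product_dist (prod_bernoulli (perturb p d z)).
    apply: is_product_dist_prod_bernoulli => i.
    by rewrite /perturb /rsign; case: (z i); apply/andP; split; nra.
  by rewrite sum_samples Pz1 expr1n.
have Wa : \sum_s W s * A s false <= 1 / 3.
  have : \sum_s W s * A s false = 1 - \sum_s W s * A s true.
    rewrite -W1 -sumrB; apply: eq_bigr => s _.
    have [_] := algA s; rewrite big_bool /= => A1.
    by rewrite -{2}[W s]mulr1 -A1; ring.
  by move=> ->; move: hnull; rewrite /pr_answer /W; lra.
have WLa : 2 / 3 <= \sum_s W s * L s * A s false.
  rewrite mix -(avg (2 / 3)) ler_wpM2l ?invr_ge0 ?exprn_ge0 //.
  apply: ler_sum => z _; apply: le_trans (halt z) _.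
  by rewrite /pr_answer le_eqVlt; apply/orP; left; apply/eqP/eq_bigr => s _; rewrite WLz.
apply: le_trans (second_moment_ge _ _ _ _ _ W0 A01 W1 WL1 Wa WLa) _.
under eq_bigr do rewrite expr2 mulrA.
rewrite mix le_eqVlt; apply/orP; left; apply/eqP.
(* The average over the second sign vector [w] is the same for every [z], so the two averages over
   [z] agree term by term. *)
rewrite -[RHS]avg; congr (_ * _); apply: eq_bigr => z _.
rewrite expr_div_n -(sum_rsign_prod _ _ _ _ z).
transitivity (N^-1 * \sum_w \sum_s W s * Lz z s * Lz w s).
  rewrite exchange_big /= mulr_sumr; apply: eq_bigr => s _.
  by rewrite -mulr_sumr /L; ring.
rewrite mulrC; congr (_ / _); apply: eq_bigr => w _.
rewrite -lratio_correlation // -sum_samples; apply: eq_bigr => s _.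
by rewrite /W /Lz -!big_split; apply: eq_bigr => j _; rewrite /= mulrA.
Qed.

(** * Choice of constants and conclusion *)

Theorem theorem4p13 (R : realType) :
  exists eps0 : R, 0 < eps0 /\
  exists c : R, 0 < c /\
    forall (n : nat) (eps : R), (2 <= n)%N -> 0 < eps < eps0 ->
    forall (m : nat) (A : samples (cube n) m -> {ffun bool -> R}),
      is_algorithm A ->
      distinguishes (bern_prod n (1 / n%:R)) eps A ->
      c * (Num.sqrt n%:R / eps ^+ 2) <= m%:R.
Proof.
(* This keeps [d = 16 * eps] below [1 / 2]; then [d / 8 = 2 * eps] exceeds [eps] strictly. *)
exists (1 / 32); split; first by lra.
(* Chosen so that [512 / 2048 = 1 / 4], whose square is the [1 / 16] in [hx]. *)
exists (1 / 2048); split; first by lra.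
move=> n eps n2 /andP[e0 e1] m A algA distA; rewrite leNgt; apply/negP => hm.
have nR : 2 <= n%:R :> R by rewrite ler_nat.
have m0 : 0 <= m%:R :> R by exact: ler0n.
set p : R := 1 / n%:R in distA.
have np : n%:R * p = 1 by rewrite /p; field; lra.
have p0 : 0 < p by rewrite /p divr_gt0 //; lra.
have p2 : p <= 1 / 2 by nra.
pose d := 16 * eps.
have hn : 2 / 3 <= pr_answer A (bern_prod n p) true.
  by apply: (distA _ _).1 => //; apply: is_product_dist_bern_prod; lra.
have ha z : 2 / 3 <= pr_answer A (prod_bernoulli (perturb p d z)) false.
  apply: (distA _ _).2.
    apply: is_product_dist_prod_bernoulli => i.
    by rewrite /perturb /rsign /d; case: (z i); apply/andP; split; nra.
  apply: lt_le_trans (perturb_l1_dist _ _ d z n2 _); rewrite /d; lra.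
have := mixture_second_moment_ge _ _ _ p d A _ _ _ algA hn ha.
move=> /(_ ltac:(lra) ltac:(rewrite /d; lra) ltac:(rewrite /d; nra)).
set t := d ^+ 2 * p / (1 - p) => hL.
have t0 : 0 <= t.
  by apply: divr_ge0; [exact: mulr_ge0 (sqr_ge0 _) (ltW p0) | lra].
(* [512] is [16 ^ 2] times the bound 2 on [1 / (1 - p)]. *)
have tn : t * n%:R <= 512 * eps ^+ 2.
  have -> : t * n%:R = 256 * eps ^+ 2 / (1 - p).
    transitivity (256 * eps ^+ 2 * (n%:R * p) / (1 - p)); last by rewrite np mulr1.
    by rewrite /t /d; field; lra.
  rewrite ler_pdivrMr; last by lra.
  by have := sqr_ge0 eps; nra.
have hm' : m%:R * eps ^+ 2 < 1 / 2048 * Num.sqrt n%:R.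
  by move: hm; rewrite mulrA ltr_pdivlMr // exprn_gt0.
have sq : Num.sqrt n%:R ^+ 2 = n%:R :> R by rewrite sqr_sqrtr //; lra.
have hm2 : (m%:R * eps ^+ 2) ^+ 2 <= (1 / 2048) ^+ 2 * n%:R.
  have h0 : 0 <= m%:R * eps ^+ 2 by exact: mulr_ge0 m0 (sqr_ge0 _).
  by rewrite -sq -exprMn lerXn2r ?nnegrE ?(ltW hm') // (le_trans h0 (ltW hm')).
have hx : n%:R * (m%:R * t) ^+ 2 <= 1 / 16.
  have h : (m%:R * t * n%:R) ^+ 2 <= (512 * (m%:R * eps ^+ 2)) ^+ 2.
    have h0 : 0 <= m%:R * t * n%:R by exact: mulr_ge0 (mulr_ge0 m0 t0) (ler0n _ _).
    have h1 : m%:R * t * n%:R <= 512 * (m%:R * eps ^+ 2).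
      by rewrite -mulrA [leRHS]mulrCA ler_wpM2l.
    by rewrite lerXn2r ?nnegrE // (le_trans h0).
  rewrite -(ler_pM2r (x := n%:R)); last by lra.
  have -> : n%:R * (m%:R * t) ^+ 2 * n%:R = (m%:R * t * n%:R) ^+ 2 by ring.
  apply: le_trans h _; rewrite exprMn.
  by move: hm2; set y := (m%:R * _) ^+ 2; lra.
have mt0 : 0 <= m%:R * t by exact: mulr_ge0.
have hU : 0 <= (m%:R * t) ^+ 2 by exact: sqr_ge0.
have mt : m%:R * t <= 1.
  have h : 2 * (m%:R * t) ^+ 2 <= n%:R * (m%:R * t) ^+ 2 by rewrite ler_wpM2r.
  by rewrite -(ler_pXn2r (n := 2)) ?nnegrE ?expr1n //; lra.
have hu := even_part_le _ t m t0 mt.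
have := exprD1_le _ ((m%:R * t) ^+ 2) n hU ltac:(lra).
have t1 : 0 <= 1 - t.
  have : eps ^+ 2 <= 1 / 1024 by nra.
  nra.
have hpow : 32 / 27 <= (1 + (m%:R * t) ^+ 2) ^+ n.
  apply: le_trans hL _; rewrite lerXn2r ?nnegrE //; last by lra.
  by rewrite divr_ge0 // addr_ge0 // exprn_ge0 //; lra.
(* The contradiction is [1 / (1 - 1 / 16) = 16 / 15 < 32 / 27]. *)
apply/negP; rewrite -ltNge; apply: lt_le_trans hpow.
rewrite invf_plt ?posrE; lra.
Qed.
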